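(* Let $\Phi\in\mathcal B_0$, let $V\in L^{\infty,0}(\mathbb R^d)$ be rotationally symmetric, and suppose that $\mathcal H_{\Phi,V}=\Phi(-\Delta)+V$ has a unique, strictly positive ground state $\varphi$. Then $\varphi$ is rotationally symmetric.
   Context: Fix $d\in\mathbb N$. A Bernstein function is a $\Phi\in C^\infty((0,\infty))$ with $\Phi\ge0$ and $(-1)^n\Phi^{(n)}\le0$ for all $n\ge1$. It has a unique representation $\Phi(z)=a_\Phi+b_\Phi z+\int_0^\infty(1-e^{-zt})\mu_\Phi(dt)$ with $a_\Phi,b_\Phi\ge0$ and $\int_{(0,\infty)}(1\wedge t)\mu_\Phi(dt)<\infty$. It is complete if $\mu_\Phi(dt)=m_\Phi(t)dt$ with $m_\Phi$ completely monotone. $\mathcal B_0$ is the set of complete Bernstein functions with $a_\Phi=b_\Phi=0$. $\Phi(-\Delta)$ is the self-adjoint operator on $L^2(\mathbb R^d)$ with Fourier multiplier $\Phi(|\xi|^2)$. $L^{\infty,0}(\mathbb R^d)=\{h\in L^\infty(\mathbb R^d):\lim_{|x|\to\infty}h(x)=0\}$, and for $V$ in it $\mathcal H_{\Phi,V}=\Phi(-\Delta)+V$ is self-adjoint on $L^2(\mathbb R^d)$. The ground state eigenvalue is $\lambda_0=\min\mathrm{Spec}_{\rm d}(\mathcal H_{\Phi,V})$ (when the discrete spectrum is non-empty); the ground state is the corresponding eigenfunction, normalized to be strictly positive with $L^2$-norm 1. A function $f$ on $\mathbb R^d$ is rotationally symmetric if $f(\mathrm Rx)=f(x)$ for every rotation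 $\mathrm R\in\mathrm{SO}(d)$. *)

(* Defs.v *)
From HB Require Import structures.
From mathcomp Require Import all_boot all_order all_algebra.
From mathcomp Require Import all_classical all_reals all_analysis.
From mathcomp Require Import complex.
Set Implicit Arguments.
Unset Strict Implicit.
Unset Printing Implicit Defensive.
Import Order.TTheory GRing.Theory Num.Theory.
Import numFieldNormedType.Exports.
Local Open Scope classical_set_scope.
Local Open Scope ring_scope.
Local Open Scope complex_scope.

(* [Rd R d] is R^d with its Borel (product) sigma-algebra. *)
Notation Rd R d := (d.-tuple (measurableTypeR R)).

Section lebesgue_measure_Rd.
Context {R : realType}.

Definition cons_Rd n (p : measurableTypeR R * Rd R n) : Rd R n.+1 :=
  [the n.+1.-tuple _ of p.1 :: p.2].

Lemma measurable_cons_Rd n : measurable_fun [set: _] (@cons_Rd n).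
Proof. exact: measurable_cons. Qed.

Section step.
Variables (n : nat) (mu : {sigma_finite_measure set (Rd R n) -> \bar R}).

Definition leb_step : set (Rd R n.+1) -> \bar R :=
  pushforward (lebesgue_measure \x mu)%E (@cons_Rd n).

Let leb_step0 : leb_step set0 = 0%E.
Proof. by rewrite /leb_step /pushforward preimage_set0 measure0. Qed.

Let leb_step_ge0 A : (0 <= leb_step A)%E.
Proof. exact: (measure_ge0 (lebesgue_measure \x mu)%E). Qed.

Let leb_step_sigma_additive : semi_sigma_additive leb_step.
Proof.
have mc := @measurable_cons_Rd n.
move=> F mF tF mUF; rewrite /leb_step /pushforward preimage_bigcup.
apply: measure_semi_sigma_additive.
- by move=> k; rewrite -[X in measurable X]setTI; exact: mc.
- apply/trivIsetP => /= i j _ _ ij; rewrite -preimage_setI.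
  by move/trivIsetP : tF => /(_ _ _ _ _ ij) ->//; rewrite preimage_set0.
- by rewrite -preimage_bigcup -[X in measurable X]setTI; exact: mc.
Qed.

HB.instance Definition _ := isMeasure.Build _ _ _ leb_step
  leb_step0 leb_step_ge0 leb_step_sigma_additive.

Let leb_step_sigma_finite : sigma_finite setT leb_step.
Proof.
have /sigma_finiteP[F [FT ndF FP]] := sigma_finiteT (@lebesgue_measure R).
have /sigma_finiteP[G [GT ndG GP]] := sigma_finiteT mu.
pose split (x : Rd R n.+1) : measurableTypeR R * Rd R n :=
  (thead x, [tuple of behead x]).
have splitK : cancel (@cons_Rd n) split.
  by case=> a t; rewrite /split theadE; congr pair; exact/val_inj.
have msplit : measurable_fun [set: _] split.
  by apply/measurable_fun_pair; [exact: measurable_tnth|exact: measurable_behead].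
exists (fun k => split @^-1` (F k `*` G k)).
  apply/seteqP; split => // x _.
  have [i _ Fi] : (\bigcup_i F i) (split x).1 by rewrite -FT.
  have [j _ Gj] : (\bigcup_i G i) (split x).2 by rewrite -GT.
  exists (maxn i j) => //; split.
    by move: Fi; exact/subsetPset/ndF/leq_maxl.
  by move: Gj; exact/subsetPset/ndG/leq_maxr.
move=> k; have [mFk Fkoo] := FP k; have [mGk Gkoo] := GP k.
have mFG : measurable (F k `*` G k) by exact: measurableX.
split; first by rewrite -[X in measurable X]setTI; exact: msplit.
rewrite /leb_step /pushforward -comp_preimage.
rewrite (_ : split \o _ = id); last by apply/funext => x; exact: splitK.
by rewrite preimage_id product_measure1E// lte_mul_pinfty// ge0_fin_numE.
Qed.

HB.instance Definition _ := Measure_isSigmaFinite.Build _ _ _ leb_step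
  leb_step_sigma_finite.

End step.

(* Lebesgue measure on R^n, as the n-fold product of the one on R. *)
Fixpoint leb (n : nat) : {sigma_finite_measure set (Rd R n) -> \bar R} :=
  match n return {sigma_finite_measure set (Rd R n) -> \bar R} with
  | 0 => [the {sigma_finite_measure set _ -> \bar R} of \d_([tuple] : Rd R 0)]
  | n.+1 => [the {sigma_finite_measure set _ -> \bar R} of leb_step (leb n)]
  end.

Lemma leb_box n (A : 'I_n -> set (measurableTypeR R)) :
  (forall i, measurable (A i)) ->
  leb n [set x | forall i, A i (tnth x i)] =
    (\prod_(i < n) lebesgue_measure (A i))%E.
Proof.
elim: n A => [|n IH] A mA.
  rewrite big_ord0 /= /dirac indicE.
  by case: (boolP (_ \in _)) => // /negP[]; rewrite inE => -[].
rewrite big_ord_recl -IH//= /leb_step /pushforward.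
have mB : measurable [set x : Rd R n | forall i, A (lift ord0 i) (tnth x i)].
  rewrite (_ : mkset _ = \bigcap_(i in [set: 'I_n])
    ((fun x : Rd R n => tnth x i) @^-1` A (lift ord0 i))); last first.
    by apply/seteqP; split => [x /= h i _|x /= h i]; [exact: h|exact: (h i)].
  apply: fin_bigcap_measurable => // i _.
  by rewrite -[X in measurable X]setTI; exact: measurable_tnth.
rewrite -product_measure1E//; congr (_ _).
apply/seteqP; split => -[a t] /=.
  move=> h; split; first exact: (h ord0).
  by move=> i; have := h (lift ord0 i); rewrite tnthS.
move=> [h0 h] i; case: (unliftP ord0 i) => [j ->|->//].
by rewrite tnthS.
Qed.

End lebesgue_measure_Rd.

Section Euclidean.
Context {R : realType} {d : nat}.
Implicit Types x y : Rd R d.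

Definition coord_Rd x (i : 'I_d) : R := tnth x i.
Definition dotp x y : R := \sum_(i < d) coord_Rd x i * coord_Rd y i.
Definition enorm x : R := Num.sqrt (dotp x x).

Definition SO : set 'M[R]_d := [set M | M *m M^T = 1%:M /\ \det M = 1].
Definition rot (M : 'M[R]_d) x : Rd R d :=
  [tuple (\sum_(j < d) M i j * coord_Rd x j : measurableTypeR R) | i < d].

(* Functions stand for their Lebesgue-a.e. classes, so all pointwise identities
   are required almost everywhere. *)
Definition rotationally_symmetric (f : Rd R d -> R) : Prop :=
  forall M, SO M -> {ae leb d, forall x, f (rot M x) = f x}.

Definition Linf0 (h : Rd R d -> R) : Prop :=
  [/\ measurable_fun [set: Rd R d] h,
      ('N[leb d]_+oo[EFin \o h] < +oo)%E &
      forall e : R, 0 < e ->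
        exists r, {ae leb d, forall x, r <= enorm x -> `|h x| <= e}].

End Euclidean.

Section Bernstein.
Context {R : realType}.
Implicit Types Phi m : R -> R.

(* Only the values on (0, +oo) of [Phi] and [m] matter. *)
Definition smooth_pos Phi : Prop :=
  forall n x, 0 < x -> derivable (derive1n n Phi) x 1.

Definition bernstein Phi : Prop :=
  [/\ smooth_pos Phi,
      forall x, 0 < x -> 0 <= Phi x &
      forall n x, (0 < n)%N -> 0 < x -> (-1) ^+ n * derive1n n Phi x <= 0].

Definition completely_monotone m : Prop :=
  smooth_pos m /\ forall n x, 0 < x -> 0 <= (-1) ^+ n * derive1n n m x.

Definition bernstein_triplet Phi (a b : R)
    (mu : {measure set (measurableTypeR R) -> \bar R}) : Prop :=
  [/\ 0 <= a, 0 <= b,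
      (\int[mu]_(t in `]0%R, +oo[) (Num.min 1 t)%:E < +oo)%E &
      forall z : R, 0 < z ->
        ((Phi z)%:E = (a + b * z)%:E
          + \int[mu]_(t in `]0%R, +oo[) (1 - expR (- (z * t)))%:E)%E].

Definition has_density (mu : {measure set (measurableTypeR R) -> \bar R}) m :=
  forall A : set (measurableTypeR R), measurable A -> A `<=` `]0, +oo[ ->
    mu A = (\int[lebesgue_measure]_(t in A) (m t)%:E)%E.

Definition complete_bernstein Phi (a b : R) : Prop :=
  bernstein Phi /\
  exists (mu : {measure set (measurableTypeR R) -> \bar R}) m,
    [/\ bernstein_triplet Phi a b mu, completely_monotone m & has_density mu m].

Definition B0 : set (R -> R) := [set Phi | complete_bernstein Phi 0 0].

End Bernstein.

Section L2.
Context {R : realType} {d : nat}.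
Local Notation cfun := (Rd R d -> R[i]).
Implicit Types f g h : cfun.

Definition cmeasurable f : Prop :=
  measurable_fun [set: Rd R d] (fun x => complex.Re (f x)) /\
  measurable_fun [set: Rd R d] (fun x => complex.Im (f x)).

Definition cnorm (p : R) f : \bar R :=
  'N[leb d]_(p%:E)[EFin \o (@Normc.normc R \o f)].

Definition Lp (p : R) : set cfun :=
  [set f | cmeasurable f /\ (cnorm p f < +oo)%E].

Definition aeeq f g : Prop := {ae leb d, forall x, f x = g x}.

Definition cint f : R[i] :=
  Rintegral (leb d) setT (fun x => complex.Re (f x)) +i*
  Rintegral (leb d) setT (fun x => complex.Im (f x)).

(* (2 pi)^(-d/2) \int e^(-i x.xi) f(x) dx *)
Definition fourier1 f : cfun := fun xi =>
  ((Num.sqrt (2 * pi))^-1 ^+ d)%:C *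
  cint (fun x => (cos (dotp x xi) -i* sin (dotp x xi)) * f x).

(* Graph of the L^2 Fourier transform: the continuous extension of [fourier1]
   from L^1 /\ L^2 to L^2. *)
Definition fourier f g : Prop :=
  [/\ Lp 2 f, Lp 2 g &
   exists u : nat -> cfun,
     [/\ forall n, Lp 1 (u n) /\ Lp 2 (u n),
         cnorm 2 (u n - f) @[n --> \oo] --> 0%E &
         cnorm 2 (fourier1 (u n) - g) @[n --> \oo] --> 0%E]].

(* Possibly unbounded operators on L^2(R^d; C) are given by their graphs: [T f g]
   means that f lies in the domain of T and T f = g, up to null sets. *)
Definition operator := cfun -> cfun -> Prop.

Definition phi_laplacian (Phi : R -> R) : operator := fun f g =>
  exists fh gh, [/\ fourier f fh, fourier g gh &
    aeeq gh (fun xi => (Phi (enorm xi ^+ 2))%:C * fh xi)].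

Definition schrodinger (Phi : R -> R) (V : Rd R d -> R) : operator := fun f g =>
  Lp 2 g /\ exists2 h, phi_laplacian Phi f h &
    aeeq g (fun x => h x + (V x)%:C * f x).

Implicit Types (T : operator) (z : R[i]).

(* z is in the resolvent set when T - z is a bijection from its domain onto L^2
   with bounded inverse; the estimate contains the injectivity. *)
Definition resolvent_set T : set R[i] := [set z |
  (forall g, Lp 2 g ->
     exists f h, T f h /\ aeeq (fun x => h x - z * f x) g) /\
  exists C : R, forall f h, T f h ->
     (cnorm 2 f <= C%:E * cnorm 2 (fun x => h x - z * f x)%R)%E].

Definition spectrum T : set R[i] := ~` resolvent_set T.

Definition eigenfunction T z f : Prop := T f (fun x => z * f x).

Definition eigenvalue_of T z : Prop :=
  exists2 f, eigenfunction T z f & ~ aeeq f (fun=> 0).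

Definition finite_multiplicity T z : Prop :=
  exists n (e : 'I_n -> cfun),
    (forall i, eigenfunction T z (e i)) /\
    forall f, eigenfunction T z f ->
      exists c : 'I_n -> R[i], aeeq f (fun x => \sum_(i < n) c i * e i x).

Definition isolated_in (A : set R[i]) z : Prop :=
  A z /\ exists2 r : R, 0 < r &
    forall w, A w -> Normc.normc (w - z) < r -> w = z.

Definition discrete_spectrum T : set R[i] := [set z |
  [/\ isolated_in (spectrum T) z, eigenvalue_of T z & finite_multiplicity T z]].

(* The order of R[i] compares only numbers with equal imaginary parts; the
   operators considered are self-adjoint, hence have real spectrum. *)
Definition ground_state_eigenvalue T (lambda0 : R) : Prop :=
  discrete_spectrum T lambda0%:C /\
  forall z, discrete_spectrum T z -> lambda0%:C <= z.

Definition ground_state T (phi : Rd R d -> R) : Prop :=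
  let phiC : cfun := fun x => (phi x)%:C in
  [/\ exists2 lambda0 : R,
        ground_state_eigenvalue T lambda0 & eigenfunction T lambda0%:C phiC,
      {ae leb d, forall x, 0 < phi x} &
      cnorm 2 phiC = 1%E].

Definition unique_ground_state T (phi : Rd R d -> R) : Prop :=
  ground_state T phi /\
  forall psi, ground_state T psi -> {ae leb d, forall x, psi x = phi x}.

End L2.

(* Main.v *)
From HB Require Import structures.
From mathcomp Require Import all_boot all_order all_algebra.
From mathcomp Require Import all_classical all_reals all_analysis.
From mathcomp Require Import measurable_realfun complex.
Require Import Defs.

Set Implicit Arguments.
Unset Strict Implicit.
Unset Printing Implicit Defensive.
Import Order.TTheory GRing.Theory Num.Theory.
Local Open Scope classical_set_scope.
Local Open Scope ring_scope.

(** Rotating a ground state gives another ground state for the same eigenvalue,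
    so uniqueness forces the ground state to agree with each of its rotations.

    The only thing to check is that every notion entering the definition of a
    ground state is equivariant under [f |-> f \o rot M]: measurability, the
    [L^p] norms, almost everywhere identities, and the Fourier transform, which
    commutes with [rot M] because [dotp (rot M x) (rot M xi) = dotp x xi].  The
    multiplier [Phi (|xi|^2)] and the potential [V] are rotation invariant, the
    second one by hypothesis and only almost everywhere.  All of this rests on
    one fact, [leb_rot]: Lebesgue measure on R^d is rotation invariant.

    Here Lebesgue measure is built as an iterated product, which gives
    translation invariance by induction on the dimension
    ([leb_iso_translate]).  Rotation invariance follows by the usual argument
    for uniqueness of Haar measure, in which Fubini's theorem relates the
    measures of [A] and of its rotated copy: for the ball [B],
      [mu A * mu B] = measure of the (x, y) with [x + My] in [A], [My] in [B]
                    = measure of the (x, y) with [My] in [A], [My - x] in [B]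
                    = [mu (M^-1 A) * mu B],
    the middle equality being a translation of [y] by a vector depending on
    [x].  Since [0 < mu B < +oo], the factor [mu B] cancels. *)

(** * Integration along measure isomorphisms *)

Section preimage.
Context d d' (T : measurableType d) (T' : measurableType d').

Lemma measurable_preimage (f : T -> T') (A : set T') :
  measurable_fun setT f -> measurable A -> measurable (f @^-1` A).
Proof. by move=> mf mA; rewrite -[X in measurable X]setTI; exact: mf. Qed.

End preimage.

Section measure_isomorphism.
Context d (T : measurableType d) (R : realType).

(** The inverse [g] is part of the data so that simple functions can be carried
    both ways, which transports the integrals of all functions. *)
Definition measure_iso (mu : set T -> \bar R) (f g : T -> T) : Prop :=
  [/\ cancel f g, cancel g f,
      measurable_fun setT f, measurable_fun setT g &
      forall A, measurable A -> mu (f @^-1` A) = mu A].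

Variable mu : {measure set T -> \bar R}.

Import HBNNSimple.

Lemma measure_iso_sym f g : measure_iso mu f g -> measure_iso mu g f.
Proof.
move=> [fK gK mf mg fmu]; split=> // A mA.
rewrite -fmu; last exact: measurable_preimage.
by rewrite -comp_preimage (_ : g \o f = id) ?preimage_id//; apply/funext.
Qed.

Section nnsfun_comp.
Variables (f : T -> T) (mf : measurable_fun setT f) (h : {nnsfun T >-> R}).

Let hf : T -> R := h \o f.
Let hf_measurable : measurable_fun setT hf.
Proof. exact: measurableT_comp. Qed.
Let hf_fimfun : finite_set (range hf).
Proof.
apply: (@sub_finite_set _ _ (range h)); last exact: fimfunP.
by move=> _ [x _ <-]; exists (f x).
Qed.
Let hf_ge0 x : 0 <= hf x.
Proof. exact: fun_ge0. Qed.

HB.instance Definition _ := isMeasurableFun.Build _ _ _ _ hf hf_measurable.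
HB.instance Definition _ := FiniteImage.Build _ _ hf hf_fimfun.
HB.instance Definition _ := isNonNegFun.Build _ _ hf hf_ge0.

Definition nnsfun_comp : {nnsfun T >-> R} := hf.

End nnsfun_comp.

Lemma sintegral_comp f g (h : {nnsfun T >-> R}) :
  measure_iso mu f g -> sintegral mu (h \o f) = sintegral mu h.
Proof.
move=> [_ _ _ _ fmu]; apply: eq_fsbigr => x _; congr (_ * _)%E.
by rewrite comp_preimage fmu.
Qed.

Lemma simple_minorants_comp f g (F : T -> \bar R) : measure_iso mu f g ->
  [set sintegral mu h | h in [set h : {nnsfun T >-> R} |
    forall x, (h x)%:E <= (F \o f) x]%E] =
  [set sintegral mu h | h in [set h : {nnsfun T >-> R} |
    forall x, (h x)%:E <= F x]%E].
Proof.
move=> fg; have gf := measure_iso_sym fg; have [fK gK mf mg _] := fg.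
apply/seteqP; split=> _ [h /= hF <-].
  exists (nnsfun_comp mg h); last exact: sintegral_comp gf.
  by move=> x /=; rewrite (le_trans (hF _))//= gK.
exists (nnsfun_comp mf h); [by move=> x; exact: hF|].
by rewrite (sintegral_comp _ fg).
Qed.

(** The integral is a difference of suprema over simple functions, and composing
    with [f] is a bijection between the simple functions below [F] and those
    below [F \o f]: so [F] may be arbitrary.  This applies in particular to
    [fourier1 u], whose measurability would be a separate matter. *)
Lemma integral_comp f g (F : T -> \bar R) : measure_iso mu f g ->
  (\int[mu]_x F (f x) = \int[mu]_x F x)%E.
Proof.
move=> fg; rewrite /integral !patch_setT funepos.unlock funeneg.unlock.
congr (ereal_sup _ - ereal_sup _)%E.
  exact: (simple_minorants_comp (fun x => maxe (F x) 0) fg).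
exact: (simple_minorants_comp (fun x => maxe (- F x) 0)%E fg).
Qed.

Lemma ae_comp f g (P : set T) : measure_iso mu f g ->
  {ae mu, forall x, P x} -> {ae mu, forall x, P (f x)}.
Proof.
move=> [_ _ mf _ fmu] [N [mN N0 PN]]; exists (f @^-1` N); split.
- exact: measurable_preimage.
- by rewrite fmu.
- by move=> x /= nP; apply: PN.
Qed.

Lemma Lnorm_comp f g p (F : T -> \bar R) : measure_iso mu f g ->
  ('N[mu]_p%:E[F \o f] = 'N[mu]_p%:E[F])%E.
Proof.
move=> fg; rewrite unlock; congr (_ `^ _)%E.
exact: (integral_comp (fun x => `|F x| `^ p)%E fg).
Qed.

End measure_isomorphism.

(** * Translation invariance of Lebesgue measure *)

Section product_isomorphism.
Context d1 d2 (T1 : measurableType d1) (T2 : measurableType d2) (R : realType).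
Variables (m1 : {sigma_finite_measure set T1 -> \bar R}).
Variables (m2 : {sigma_finite_measure set T2 -> \bar R}).

Lemma product_measure1_comp f1 g1 f2 g2 (A : set (T1 * T2)) :
  measure_iso m1 f1 g1 -> measure_iso m2 f2 g2 -> measurable A ->
  ((m1 \x m2) ((fun p => (f1 p.1, f2 p.2)) @^-1` A) = (m1 \x m2) A)%E.
Proof.
move=> i1 [_ _ _ _ f2m] mA; rewrite /product_measure1.
rewrite -[RHS](integral_comp _ i1); apply: eq_integral => x _ /=.
by rewrite -[in RHS]f2m; [rewrite !xsectionE|exact: measurable_xsection].
Qed.

End product_isomorphism.

Section translation.
Context {R : realType}.

Definition translate n (v x : Rd R n) : Rd R n :=
  [tuple (coord_Rd x i + coord_Rd v i : measurableTypeR R) | i < n].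
Definition opp_Rd n (v : Rd R n) : Rd R n :=
  [tuple (- coord_Rd v i : measurableTypeR R) | i < n].

Lemma coord_translate n (v x : Rd R n) i :
  coord_Rd (translate v x) i = coord_Rd x i + coord_Rd v i.
Proof. by rewrite /coord_Rd tnth_mktuple. Qed.

Lemma coord_opp_Rd n (v : Rd R n) i : coord_Rd (opp_Rd v) i = - coord_Rd v i.
Proof. by rewrite /coord_Rd tnth_mktuple. Qed.

Lemma coord_ext n (x y : Rd R n) : coord_Rd x =1 coord_Rd y -> x = y.
Proof. by move=> xy; apply: eq_from_tnth. Qed.

Lemma translateC n (v x : Rd R n) : translate v x = translate x v.
Proof. by apply: coord_ext => i; rewrite !coord_translate addrC. Qed.

Lemma measurable_coord d (T : measurableType d) n (f : T -> Rd R n) :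
  measurable_fun setT f <->
  forall i, measurable_fun setT (fun x => coord_Rd (f x) i).
Proof. exact: measurable_fun_tnthP. Qed.

Lemma measurable_translate2 d (T : measurableType d) n (f g : T -> Rd R n) :
  measurable_fun setT f -> measurable_fun setT g ->
  measurable_fun setT (fun x => translate (f x) (g x)).
Proof.
move=> /measurable_coord mf /measurable_coord mg; apply/measurable_coord => i.
under eq_fun do rewrite coord_translate.
exact: measurable_funD.
Qed.

Lemma measurable_opp_Rd d (T : measurableType d) n (f : T -> Rd R n) :
  measurable_fun setT f -> measurable_fun setT (fun x => opp_Rd (f x)).
Proof.
move=> /measurable_coord mf; apply/measurable_coord => i.
under eq_fun do rewrite coord_opp_Rd.
exact: measurable_funN.
Qed.

Lemma lebesgue_measure_translate (a : R) (A : set (measurableTypeR R)) :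
  measurable A ->
  lebesgue_measure ((fun x : measurableTypeR R => x + a) @^-1` A) =
  lebesgue_measure A.
Proof.
move=> mA.
have mt : measurable_fun setT
    (fun x : measurableTypeR R => x + a : measurableTypeR R).
  exact: measurable_funD.
pose nu : {measure set _ -> \bar R} :=
  measure_function_pushforward__canonical__measure_function_Measure
    lebesgue_measure mt.
apply/esym/(@lebesgue_measure_unique _ nu) => // _ [[b c] _ <-] /=.
rewrite /nu /pushforward /=.
have -> : (fun x : measurableTypeR R => x + a) @^-1` [set` `]b, c]] =
    [set` `]b - a, c - a]].
  by apply/seteqP; split=> x /=; rewrite !in_itv /= ltrBlDr lerBrDr.
rewrite !lebesgue_measure_itv /= !lte_fin ltrD2r -!EFinB.
by rewrite opprB addrA subrK.
Qed.

Lemma lebesgue_measure_iso_translate (a : R) :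
  measure_iso (@lebesgue_measure R) (fun x => x + a) (fun x => x - a).
Proof.
split; try by move=> x; rewrite ?addrK ?subrK.
- exact: measurable_funD.
- exact: measurable_funD.
- exact: lebesgue_measure_translate.
Qed.

Lemma translateK n (v : Rd R n) : cancel (translate v) (translate (opp_Rd v)).
Proof.
by move=> x; apply: coord_ext => i; rewrite !coord_translate coord_opp_Rd addrK.
Qed.

Lemma translateNK n (v : Rd R n) : cancel (translate (opp_Rd v)) (translate v).
Proof.
by move=> x; apply: coord_ext => i; rewrite !coord_translate coord_opp_Rd subrK.
Qed.

Lemma measurable_translate n (v : Rd R n) : measurable_fun setT (translate v).
Proof. exact: (@measurable_translate2 _ _ _ (cst v) id). Qed.

(** In the coordinates (head, tail) that define [leb n.+1] as a product measure,
    a translation acts on each factor separately; hence the induction. *)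
Lemma leb_iso_translate n (v : Rd R n) :
  measure_iso (leb n) (translate v) (translate (opp_Rd v)).
Proof.
split; [exact: translateK|exact: translateNK| | |].
- exact: measurable_translate.
- exact: measurable_translate.
elim: n v => [|n IH] v A mA.
  have -> // : translate v = id.
  by apply/funext => x; apply: coord_ext => -[].
rewrite /= /leb_step /pushforward.
pose w : Rd R n := [tuple of behead v].
have iso1 := lebesgue_measure_iso_translate (thead v).
have iso2 : measure_iso (leb n) (translate w) (translate (opp_Rd w)).
  by split; [exact: translateK|exact: translateNK| | |exact: IH];
    exact: measurable_translate.
have mcA : measurable (@cons_Rd _ n @^-1` A).
  by apply: measurable_preimage mA; exact: measurable_cons_Rd.
apply: etrans (product_measure1_comp iso1 iso2 mcA).
have consE (p : measurableTypeR R * Rd R n) :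
    translate v (cons_Rd p) = cons_Rd (p.1 + thead v, translate w p.2).
  case: p => a t; apply: coord_ext => i; rewrite coord_translate /coord_Rd /=.
  case: (unliftP ord0 i) => [j ->|->] /=.
    by rewrite !tnthS tnth_mktuple /coord_Rd tnth_behead; congr (_ + tnth _ _);
       apply/val_inj; rewrite /= inordK// ltnS.
  by rewrite /thead.
congr (lebesgue_measure \x leb n)%E.
by apply/seteqP; split=> p /=; rewrite consE.
Qed.

End translation.

(** * Rotation invariance of Lebesgue measure *)

Section orthogonal.
Context {R : realType} {d : nat}.
Implicit Types (x y v : Rd R d) (M : 'M[R]_d).

Definition colv x : 'cV[R]_d := \col_i coord_Rd x i.

Lemma colv_inj : injective colv.
Proof.
by move=> x y /colP xy; apply: coord_ext => i; have := xy i; rewrite !mxE.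
Qed.

Lemma colv_rot M x : colv (rot M x) = M *m colv x.
Proof.
apply/colP => i; rewrite !mxE /coord_Rd tnth_mktuple.
by apply: eq_bigr => j _; rewrite mxE.
Qed.

Lemma colv_translate v x : colv (translate v x) = colv x + colv v.
Proof. by apply/colP => i; rewrite !mxE coord_translate. Qed.

Lemma dotpE x y : dotp x y = ((colv x)^T *m colv y) 0 0.
Proof. by rewrite mxE; apply: eq_bigr => i _; rewrite !mxE. Qed.

Lemma rot_translate M v x :
  rot M (translate v x) = translate (rot M v) (rot M x).
Proof.
by apply: colv_inj; rewrite !(colv_rot, colv_translate) mulmxDr.
Qed.

Lemma dotp_opp_translate x y :
  let z := translate (opp_Rd y) x in let z' := translate (opp_Rd x) y in
  dotp z z = dotp z' z'.
Proof.
apply: eq_bigr => i _; rewrite !coord_translate !coord_opp_Rd.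
by rewrite -mulrNN !opprB.
Qed.

Lemma measurable_rot M : measurable_fun setT (rot M).
Proof.
apply/measurable_coord => i.
under eq_fun do rewrite /coord_Rd tnth_mktuple.
apply: measurable_sum => j; apply: measurable_funM => //.
exact: measurable_tnth.
Qed.

Lemma measurable_dotp dd (T : measurableType dd) (f g : T -> Rd R d) :
  measurable_fun setT f -> measurable_fun setT g ->
  measurable_fun setT (fun t => dotp (f t) (g t)).
Proof.
move=> /measurable_coord mf /measurable_coord mg.
by apply: measurable_sum => j; exact: measurable_funM.
Qed.

(** The radius is [sqrt d], so that the unit cube fits inside, while the ball
    itself fits inside the cube [[-d, d]^d]; both have an explicit measure. *)
Definition cball : set (Rd R d) := [set x | dotp x x <= d%:R].

Lemma measurable_cball : measurable cball.
Proof.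
have mdot : measurable_fun setT (fun x : Rd R d => dotp x x).
  by apply: measurable_dotp; exact: measurable_id.
have := measurable_preimage mdot (measurable_itv `]-oo, (d%:R : R)]).
by congr measurable; apply/seteqP; split=> x /=; rewrite in_itv.
Qed.

Lemma measurable_box (I : 'I_d -> set (measurableTypeR R)) :
  (forall i, measurable (I i)) ->
  measurable [set x : Rd R d | forall i, I i (tnth x i)].
Proof.
move=> mI; rewrite (_ : mkset _ = \bigcap_(i in [set: 'I_d])
    ((fun x : Rd R d => tnth x i) @^-1` I i)).
  apply: fin_bigcap_measurable => // i _.
  by apply: measurable_preimage => //; exact: measurable_tnth.
by apply/seteqP; split=> [x /= h i _|x /= h i]; [exact: h|exact: (h i)].
Qed.

Lemma leb_cball_gt0 : (0 < leb d cball)%E.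
Proof.
have := leb_box (fun _ : 'I_d => measurable_itv `[0, 1 : R]).
rewrite big1 => [box|i _]; last first.
  by rewrite lebesgue_measure_itv /= lte01 oppr0 adde0.
apply: (@lt_le_trans _ _ 1%E); first exact: lte01.
rewrite -box; apply: le_measure; rewrite ?inE.
- by apply: (@measurable_box (fun=> [set` `[0, 1 : R]])).
- exact: measurable_cball.
move=> x /= x01; rewrite /cball /= /dotp.
rewrite -[d in d%:R]card_ord -sum1_card natr_sum; apply: ler_sum => i _.
have := x01 i; rewrite /coord_Rd /= in_itv /= => /andP[x0 x1].
by rewrite mulr_ile1.
Qed.

Lemma leb_cball_lty : (leb d cball < +oo)%E.
Proof.
have mI (i : 'I_d) := measurable_itv `[- d%:R, d%:R : R].
apply: (@le_lt_trans _ _ (leb d [set x : Rd R d | forall i,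
    [set` `[- d%:R, d%:R]] (tnth x i)])).
  apply: le_measure; rewrite ?inE.
  - exact: measurable_cball.
  - exact: (measurable_box mI).
  move=> x /= xd i; rewrite in_itv /= -ler_norml.
  rewrite -ler_sqr ?nnegrE// real_normK ?num_real// !expr2.
  apply: (@le_trans _ _ (dotp x x)).
    rewrite /dotp (bigD1 i)//= lerDl sumr_ge0// => j _.
    by rewrite -expr2 sqr_ge0.
  rewrite (le_trans xd)// -natrM ler_nat leq_pmulr//.
  exact: leq_trans (ltn_ord i).
rewrite (leb_box mI) ltey_eq prode_fin_num// => i _.
by rewrite lebesgue_measure_itv /=; case: ifP.
Qed.

Variables (M : 'M[R]_d) (MMt : M *m M^T = 1%:M).

Lemma rotK : cancel (rot M) (rot M^T).
Proof.
by move=> x; apply: colv_inj; rewrite !colv_rot mulmxA (mulmx1C MMt) mul1mx.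
Qed.

Lemma rotTK : cancel (rot M^T) (rot M).
Proof.
by move=> x; apply: colv_inj; rewrite !colv_rot mulmxA MMt mul1mx.
Qed.

Lemma dotp_rot x y : dotp (rot M x) (rot M y) = dotp x y.
Proof.
by rewrite !dotpE !colv_rot trmx_mul -mulmxA (mulmxA _ M) (mulmx1C MMt) mul1mx.
Qed.

Lemma enorm_rot x : enorm (rot M x) = enorm x.
Proof. by rewrite /enorm dotp_rot. Qed.

Lemma cball_rot x : cball (rot M x) <-> cball x.
Proof. by rewrite /cball /= dotp_rot. Qed.

(** [E] and [E'] are the two sets of pairs of the Haar uniqueness argument.
    Their slices at a fixed [x] are translates of each other, so they have the
    same measure; slicing at a fixed [y] computes it as [mu cball * mu A] and as
    [mu (rot M @^-1` A) * mu cball] respectively. *)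
Lemma leb_rot (A : set (Rd R d)) :
  measurable A -> leb d (rot M @^-1` A) = leb d A.
Proof.
move=> mA; pose mu := @leb R d.
pose E : set (Rd R d * Rd R d) :=
  [set p | A (translate p.1 (rot M p.2)) /\ cball (rot M p.2)].
pose E' : set (Rd R d * Rd R d) :=
  [set p | A (rot M p.2) /\ cball (translate (opp_Rd p.1) (rot M p.2))].
have mrot2 : measurable_fun setT (fun p : Rd R d * Rd R d => rot M p.2).
  by apply: measurableT_comp; [exact: measurable_rot|exact: measurable_snd].
have mE : measurable E.
  apply: measurableI; last first.
    exact: (measurable_preimage mrot2 measurable_cball).
  apply: (measurable_preimage _ mA).
  by apply: measurable_translate2 => //; exact: measurable_fst.
have mE' : measurable E'.
  apply: measurableI; first exact: (measurable_preimage mrot2 mA).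
  apply: (measurable_preimage _ measurable_cball).
  apply: measurable_translate2 => //.
  by apply: measurable_opp_Rd; exact: measurable_fst.
(* For fixed x, translating y by M^T x adds x to My. *)
have EE' : (mu \x mu)%E E = (mu \x mu)%E E'.
  apply: eq_integral => x _ /=.
  have [_ _ _ _ tmu] := leb_iso_translate (rot M^T x).
  rewrite -[RHS]tmu; last exact: measurable_xsection.
  congr (mu _); rewrite !xsectionE; apply/seteqP; split=> y /=.
    by rewrite /E /E' /= rot_translate rotTK translateK translateC.
  by rewrite /E /E' /= rot_translate rotTK translateK translateC.
have muC F : measurable F -> (mu \x mu)%E F = (\int[mu]_y mu (ysection F y))%E.
  move=> mF; transitivity ((mu \x^ mu)%E F) => //.
  by apply: product_measure_unique => // B C mB mC; exact: product_measure2E.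
have int_indic F (c : \bar R) : measurable F -> (0 <= c)%E ->
    (\int[mu]_y ((\1_F y)%:E * c) = mu F * c)%E.
  move=> mF c0; rewrite ge0_integralZr//; last exact: measurableT_comp.
  by rewrite integral_indic// setIT.
have mA' := measurable_preimage (measurable_rot M) mA.
have muE : (mu \x mu)%E E = (mu cball * mu A)%E.
  rewrite muC// -int_indic//; last exact: measurable_cball.
  apply: eq_integral => y _; rewrite indicE ysectionE.
  have [yB|yB] := pselect (cball y).
    rewrite mem_set// mul1e.
    have [_ _ _ _ tmu] := leb_iso_translate (rot M y); rewrite -[RHS]tmu//.
    congr (mu _); apply/seteqP; split=> x; rewrite /E /= cball_rot translateC.
      by case.
    by [].
  rewrite memNset// mul0e (_ : _ @^-1` _ = set0) ?measure0//.
  by apply/seteqP; split=> x //; rewrite /E /= cball_rot => -[].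
have muE' : (mu \x mu)%E E' = (mu (rot M @^-1` A) * mu cball)%E.
  rewrite muC// -int_indic//.
  apply: eq_integral => y _; rewrite indicE ysectionE.
  have [yA|yA] := pselect ((rot M @^-1` A) y).
    rewrite mem_set// mul1e.
    have [_ _ _ _ tmu] := leb_iso_translate (opp_Rd (rot M y)).
    rewrite -[RHS]tmu; last exact: measurable_cball.
    congr (mu _); apply/seteqP; split=> x.
      by rewrite /E' /cball /= dotp_opp_translate => -[].
    by rewrite /E' /cball /= dotp_opp_translate.
  rewrite memNset// mul0e (_ : _ @^-1` _ = set0) ?measure0//.
  by apply/seteqP; split=> x //; rewrite /E' /= => -[].
have cfin : mu cball \is a fin_num.
  by rewrite ge0_fin_numE// leb_cball_lty.
have c0 : fine (mu cball) != 0.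
  by rewrite gt_eqF// fine_gt0// leb_cball_gt0 leb_cball_lty.
move: EE'; rewrite muE muE' muleC.
move=> /(congr1 (fun z => z * ((fine (mu cball))^-1)%:E)%E).
rewrite -!muleA -(fineK cfin) -!EFinM mulfV// !mule1.
exact: esym.
Qed.

Lemma leb_iso_rot : measure_iso (leb d) (rot M) (rot M^T).
Proof.
split; [exact: rotK|exact: rotTK|exact: measurable_rot|exact: measurable_rot|].
exact: leb_rot.
Qed.

End orthogonal.

(** * Equivariance of the Schrodinger operator *)

Section equivariance.
Context {R : realType} {d : nat} (M : 'M[R]_d) (MMt : M *m M^T = 1%:M).
Local Notation cfun := (Rd R d -> R[i]).
Implicit Types (f g h : cfun).
Let iso := leb_iso_rot MMt.
Let mrot : measurable_fun setT (rot M) := measurable_rot M.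

Lemma cnorm_rot (p : R) f : cnorm p (f \o rot M) = cnorm p f.
Proof. exact: (Lnorm_comp _ _ iso). Qed.

Lemma Lp_rot (p : R) f : Lp p f -> Lp p (f \o rot M).
Proof.
move=> [[mre mim] fp]; split; last by rewrite cnorm_rot.
by split; [exact: measurableT_comp mre mrot|exact: measurableT_comp mim mrot].
Qed.

Lemma aeeq_rot f g : aeeq f g -> aeeq (f \o rot M) (g \o rot M).
Proof. exact: (ae_comp iso). Qed.

Lemma cint_rot f : cint (f \o rot M) = cint f.
Proof.
rewrite /cint /Rintegral; congr (fine _ +i* fine _)%C.
  exact: (integral_comp (fun x => (complex.Re (f x))%:E) iso).
exact: (integral_comp (fun x => (complex.Im (f x))%:E) iso).
Qed.

Lemma fourier1_rot f : fourier1 (f \o rot M) = fourier1 f \o rot M.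
Proof.
(* Substituting rot M x for x on the right, the two phases agree because rot M
   preserves dotp. *)
apply/funext => xi; rewrite /fourier1 /=; congr (_ * _).
rewrite -[RHS]cint_rot; congr cint; apply/funext => x /=.
by rewrite dotp_rot.
Qed.

Lemma fourier_rot f g : fourier f g -> fourier (f \o rot M) (g \o rot M).
Proof.
move=> [Lf Lg [u [Lu uf ug]]]; split; [exact: Lp_rot|exact: Lp_rot|].
exists (fun n => u n \o rot M); split.
- by move=> n; have [] := Lu n; split; exact: Lp_rot.
- by under eq_fun do rewrite -[_ - _]/((u _ - f) \o rot M) cnorm_rot.
- under eq_fun do rewrite fourier1_rot
    -[_ - _]/((fourier1 (u _) - g) \o rot M) cnorm_rot.
  exact: ug.
Qed.

Lemma phi_laplacian_rot Phi f g :
  phi_laplacian Phi f g -> phi_laplacian Phi (f \o rot M) (g \o rot M).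
Proof.
move=> [fh [gh [ffh ggh /aeeq_rot ghE]]].
exists (fh \o rot M), (gh \o rot M).
split; [exact: fourier_rot|exact: fourier_rot|].
by apply: filterS ghE => x /= ->; rewrite enorm_rot.
Qed.

Lemma schrodinger_rot Phi (V : Rd R d -> R) f g :
  {ae leb d, forall x, V (rot M x) = V x} ->
  schrodinger Phi V f g -> schrodinger Phi V (f \o rot M) (g \o rot M).
Proof.
move=> VM [Lg [h fh /aeeq_rot gE]]; split; first exact: Lp_rot.
exists (h \o rot M); first exact: phi_laplacian_rot.
by move: gE VM; apply: filterS2 => x /= -> ->.
Qed.

Lemma ground_state_rot Phi (V phi : Rd R d -> R) :
  {ae leb d, forall x, V (rot M x) = V x} ->
  ground_state (schrodinger Phi V) phi ->
  ground_state (schrodinger Phi V) (phi \o rot M).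
Proof.
move=> VM [[lambda0 gse ef] pos norm1]; split.
- by exists lambda0 => //; exact: (schrodinger_rot VM ef).
- exact: (ae_comp iso pos).
- by rewrite -norm1; exact: (cnorm_rot _ (fun x => (phi x)%:C%C)).
Qed.

End equivariance.

Theorem proposition4p3 (R : realType) (d : nat) (hd : (0 < d)%N)
    (Phi : R -> R) (V phi : Rd R d -> R)
    (hPhi : B0 Phi) (hV : Linf0 V) (hVsym : rotationally_symmetric V)
    (hphi : unique_ground_state (schrodinger Phi V) phi) :
  rotationally_symmetric phi.
Proof.
move=> M SOM; have [gs uniq] := hphi.
exact: uniq (ground_state_rot SOM.1 (hVsym M SOM) gs).
Qed.
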